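(* Let $S_8$ be the $8\times 8$ complex Hadamard matrix $$S_8=\begin{bmatrix} 1 & 1 & 1 & 1 & 1 & 1 & 1 & 1 \\ 1 & -1 & \mathbf{i} & -\mathbf{i} & 1 & -1 & \mathbf{i} & -\mathbf{i} \\ 1 & -1 & -\mathbf{i} & \mathbf{i} & 1 & -1 & -\mathbf{i} & \mathbf{i} \\ 1 & 1 & -1 & -1 & \mathbf{i} & \mathbf{i} & -\mathbf{i} & -\mathbf{i} \\ 1 & \mathbf{i} & 1 & \mathbf{i} & -1 & -\mathbf{i} & -1 & -\mathbf{i} \\ 1 & -\mathbf{i} & 1 & -\mathbf{i} & -1 & \mathbf{i} & -1 & \mathbf{i} \\ 1 & -1 & -1 & 1 & -1 & 1 & 1 & -1 \\ 1 & 1 & -1 & -1 & -\mathbf{i} & -\mathbf{i} & \mathbf{i} & \mathbf{i} \end{bmatrix},$$ where $\mathbf{i}$ is the imaginary unit. Then neither $S_8$ nor its transpose $S_8^T$ is Dita-type.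
   Context: A complex Hadamard matrix of order $r$ is an $r\times r$ complex matrix all of whose entries have absolute value $1$ and whose rows are pairwise orthogonal with respect to the standard Hermitian inner product. Two complex Hadamard matrices $K_1,K_2$ are equivalent if $K_1=D_1P_1K_2P_2D_2$ for some unitary diagonal matrices $D_1,D_2$ and permutation matrices $P_1,P_2$. A complex Hadamard matrix of order $N$ is called Dita-type if, for some integers $k,n\ge 2$ with $kn=N$, it is equivalent to a block matrix $$K=\begin{bmatrix} m_{11}N_1&\cdots&m_{1k}N_k\\ \vdots&&\vdots\\ m_{k1}N_1&\cdots&m_{kk}N_k\end{bmatrix},$$ where $M=(m_{ij})$ is some $k\times k$ complex Hadamard matrix and $N_1,\dots,N_k$ are some $n\times n$ complex Hadamard matrices (possibly different from each other). *)

(* Defs.v *)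
From mathcomp Require Import all_boot all_order all_algebra.
From mathcomp Require Import sesquilinear spectral reals complex.
From mathcomp Require Import ring.

Set Implicit Arguments.
Unset Strict Implicit.
Unset Printing Implicit Defensive.

Import Order.TTheory GRing.Theory Num.Theory.
Local Open Scope ring_scope.

Definition complex_hadamard (C : numClosedFieldType) (r : nat) (H : 'M[C]_r) :
    Prop :=
  (forall i j, `|H i j| = 1) /\
  (forall i j, i != j -> dotmx (row i H) (row j H) = 0).

Definition unitary_diag (C : numClosedFieldType) (r : nat) (D : 'M[C]_r) : Prop :=
  is_diag_mx D /\ D \is unitarymx.

Definition hadamard_equiv (C : numClosedFieldType) (r : nat) (K1 K2 : 'M[C]_r) :
    Prop :=
  exists D1 P1 P2 D2 : 'M[C]_r,
    [/\ unitary_diag D1, is_perm_mx P1, is_perm_mx P2, unitary_diag D2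
      & K1 = D1 *m P1 *m K2 *m P2 *m D2].

Lemma block_dim (k n r : nat) : (k * n)%N = r -> (\sum_(i < k) n)%N = r.
Proof. by rewrite sum_nat_const card_ord. Qed.

(* The dimension of an [mxblock] is a sum over the blocks, whence the cast. *)
Definition dita_block (C : numClosedFieldType) (k n r : nat)
    (e : (k * n)%N = r) (M : 'M[C]_k) (Ns : 'I_k -> 'M[C]_n) : 'M[C]_r :=
  castmx (block_dim e, block_dim e) (\mxblock_(i < k, j < k) (M i j *: Ns j)).

Definition dita_type (C : numClosedFieldType) (r : nat) (H : 'M[C]_r) : Prop :=
  exists (k n : nat) (e : (k * n)%N = r) (M : 'M[C]_k) (Ns : 'I_k -> 'M[C]_n),
    [/\ (2 <= k)%N, (2 <= n)%N, complex_hadamard M,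
        forall j, complex_hadamard (Ns j)
      & hadamard_equiv H (dita_block e M Ns)].

Definition S8 (C : numClosedFieldType) : 'M[C]_8 :=
  let i : C := 'i in
  let rows : seq (seq C) :=
    [:: [:: 1;  1;  1;  1;  1;  1;  1;  1];
        [:: 1; -1;  i; -i;  1; -1;  i; -i];
        [:: 1; -1; -i;  i;  1; -1; -i;  i];
        [:: 1;  1; -1; -1;  i;  i; -i; -i];
        [:: 1;  i;  1;  i; -1; -i; -1; -i];
        [:: 1; -i;  1; -i; -1;  i; -1;  i];
        [:: 1; -1; -1;  1; -1;  1;  1; -1];
        [:: 1;  1; -1; -1; -i; -i;  i;  i]] in
  \matrix_(a < 8, b < 8) nth 0 (nth [::] rows a) b.

Lemma S8_norm (C : numClosedFieldType) (a b : 'I_8) : `|S8 C a b| = 1.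
Proof.
rewrite mxE; case: a b => [a la] [b lb] /=.
by do 8?[case: a la => [|a] la //=]; do 8?[case: b lb => [|b] lb //=];
  rewrite ?normrN ?normr1 ?normCi.
Qed.

Lemma S8_hadamard (C : numClosedFieldType) : complex_hadamard (S8 C).
Proof.
split=> [|[a la] [b lb]]; first exact: S8_norm.
rewrite -val_eqE /= dotmxE !mxE !big_ord_recl big_ord0 !mxE /=.
by do 8?[case: a la => [|a] la //=]; do 8?[case: b lb => [|b] lb //=];
  move=> _; rewrite ?rmorphN ?rmorph1 /= ?conjCi ?mulN1r ?mulrN1 ?mul1r ?mulr1
    ?mulrNN ?mulNr ?mulrN -?expr2 ?sqrCi; ring.
Qed.

Lemma trmx_S8_hadamard (C : numClosedFieldType) : complex_hadamard (S8 C)^T.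
Proof.
split=> [a b|[a la] [b lb]]; first by rewrite mxE S8_norm.
rewrite -val_eqE /= dotmxE !mxE !big_ord_recl big_ord0 !mxE /=.
by do 8?[case: a la => [|a] la //=]; do 8?[case: b lb => [|b] lb //=];
  move=> _; rewrite ?rmorphN ?rmorph1 /= ?conjCi ?mulN1r ?mulrN1 ?mul1r ?mulr1
    ?mulrNN ?mulNr ?mulrN -?expr2 ?sqrCi; ring.
Qed.

(* Main.v *)
(** The shape of a Dita block matrix only matters through cross ratios.  If
    [k = 2], the rows [(0, a)] and [(1, a)] have an entrywise ratio depending
    only on the column block, so every row has a partner proportional to it on
    each of two fixed classes of columns; if [n = 2], the same holds for the
    transpose.  This property survives Hadamard equivalence, and both [S_8] and
    its transpose lack it.  The first column of [S_8] is constant while every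
    other column takes at least three values, so it has no partner.  For the
    same reason the first row can only be paired with the seventh, which forces
    the columns [1, 4, 6, 7] to form a class, and on those no other row is
    proportional to the second one. *)

Require Import Defs.
From mathcomp Require Import all_boot all_order all_algebra all_fingroup.
From mathcomp Require Import reals complex zify.

Set Implicit Arguments.
Unset Strict Implicit.
Unset Printing Implicit Defensive.

Import Order.TTheory GRing.Theory Num.Theory.
Local Open Scope ring_scope.

(** [c] marks the two classes of columns, [p] the partner row; proportionality is cross-multiplied
    to avoid division. *)
Definition splits (C : comNzRingType) (r : nat) (H : 'M[C]_r) : Prop :=
  exists (c : 'I_r -> bool) (p : 'I_r -> 'I_r),
    (forall s, p s != s) /\
    (forall s t u, c t = c u -> H s t * H (p s) u = H s u * H (p s) t).

(** The scalars contribute the same factor to both cross products; classes are pulled back along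
    [t], partners conjugated by [s]. *)
Lemma splits_monomial (C : comNzRingType) (r : nat) (H K : 'M[C]_r)
    (d e : 'I_r -> C) (s t : 'S_r) :
  (forall i j, H i j = d i * K (s i) (t j) * e j) -> splits K -> splits H.
Proof.
move=> HE [c [p [p_neq pP]]].
exists (c \o t), (fun i => (s^-1)%g (p (s i))); split=> [i|i j l /= cjl].
  by apply: contra_neq (p_neq (s i)) => {2}<-; rewrite permKV.
rewrite !HE permKV !(mulrAC _ _ (e _)) mulrACA [RHS]mulrACA.
rewrite [d i * e j * _]mulrACA [d i * e l * _]mulrACA (mulrC (e l)).
by congr (_ * _); exact: pP.
Qed.

Lemma splits_castmx (C : comNzRingType) (r r' : nat) (e : r = r')
    (H : 'M[C]_r) :
  splits H -> splits (castmx (e, e) H).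
Proof. by case: r' / e. Qed.

Lemma hadamard_equiv_monomial (C : numClosedFieldType) (r : nat)
    (H K : 'M[C]_r) :
  hadamard_equiv H K ->
  exists (d e : 'I_r -> C) (s t : 'S_r),
    forall i j, H i j = d i * K (s i) (t j) * e j.
Proof.
case=> [D1 [P1 [P2 [D2 [[dD1 _] pP1 pP2 [dD2 _] ->]]]]].
have /diag_mxP[d ->] := dD1; have /diag_mxP[e ->] := dD2.
have /is_perm_mxP[s ->] := pP1; have /is_perm_mxP[t ->] := pP2.
(* Right multiplication by [perm_mx t] permutes columns by the inverse of [t]. *)
exists (d 0), (e 0), s, (t^-1)%g => i j.
rewrite -(mulmxA (diag_mx d)) -row_permE -(mulmxA (diag_mx d)).
by rewrite -[t in LHS]invgK -col_permE mul_mx_diag mul_diag_mx !mxE.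
Qed.

Lemma rev_ord2_neq (i : 'I_2) : rev_ord i != i.
Proof. by case: i => -[|[|i]] lti. Qed.

Lemma eq_ord2 (i j : 'I_2) : (i == 0) = (j == 0) -> i = j.
Proof. by case: i j => -[|[|i]] lti [] [|[|j]] ltj // _; apply: val_inj. Qed.

Lemma mxblock_entry (T : Type) (k n : nat) (B : 'I_k -> 'I_k -> 'M[T]_n)
    (s t : 'I_(\sum_(i < k) n)) :
  (\mxblock_(i < k, j < k) B i j) s t =
  B (tagnat.sig1 s) (tagnat.sig1 t) (tagnat.sig2 s) (tagnat.sig2 t).
Proof. by rewrite mxE. Qed.

Lemma sig2_Rank (k n : nat) (i : 'I_k) (a : 'I_n) :
  tagnat.sig2 (@tagnat.Rank k (fun=> n) i a) = a :> 'I_n.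
Proof. by apply: val_inj; rewrite tagnat.Rank2K. Qed.

Lemma splits_mxblock (C : comNzRingType) (n : nat) (M : 'M[C]_2)
    (Ns : 'I_2 -> 'M[C]_n) :
  splits (\mxblock_(i < 2, j < 2) (M i j *: Ns j)).
Proof.
exists (fun t => tagnat.sig1 t == 0).
exists (fun s =>
  @tagnat.Rank 2 (fun=> n) (rev_ord (tagnat.sig1 s)) (tagnat.sig2 s)).
split=> [s|s t u /eq_ord2 tu].
  apply: contra_neq (rev_ord2_neq (tagnat.sig1 s)) => ps.
  by rewrite -{2}ps tagnat.Rank1K.
rewrite !mxblock_entry !sig2_Rank tagnat.Rank1K !mxE tu.
by rewrite mulrACA [RHS]mulrACA (mulrC (Ns _ _ _)).
Qed.

Lemma splits_trmx_mxblock (C : comNzRingType) (k : nat) (M : 'M[C]_k)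
    (Ns : 'I_k -> 'M[C]_2) :
  splits (\mxblock_(i < k, j < k) (M i j *: Ns j))^T.
Proof.
(* Two columns in one block share the factor [M i j], so their ratio depends only on the row
   position inside the block. *)
exists (fun t => tagnat.sig2 t == 0 :> 'I_2).
exists (fun s =>
  @tagnat.Rank k (fun=> 2%N) (tagnat.sig1 s) (rev_ord (tagnat.sig2 s))).
split=> [s|s t u /eq_ord2 tu].
  apply: contra_neq (rev_ord2_neq (tagnat.sig2 s)) => ps.
  by rewrite -{2}ps sig2_Rank.
rewrite !mxE !sig2_Rank tagnat.Rank1K tu.
by rewrite mulrACA [RHS]mulrACA (mulrC (M _ _)).
Qed.

Lemma dita8_splits (C : numClosedFieldType) (H : 'M[C]_8) :
  dita_type H -> splits H \/ splits H^T.
Proof.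
case=> k [n [e [M [Ns [k_ge2 n_ge2 _ _]]]]].
case/hadamard_equiv_monomial => d [d' [s [t HE]]].
have [k2|n2] : k = 2%N \/ n = 2%N.
  clear -e k_ge2 n_ge2.
  have k_le4 : (k <= 4)%N by nia.
  case: k e k_ge2 k_le4 => [|[|[|[|[|k]]]]] e k_ge2 k_le4; lia.
- left; apply: splits_monomial HE _; apply: splits_castmx.
  by subst k; apply: splits_mxblock.
- right; apply: (@splits_monomial _ _ _ (dita_block e M Ns)^T d' d t s).
    by move=> i j; rewrite mxE HE [in RHS]mxE mulrC mulrA mulrAC.
  rewrite trmx_cast; apply: splits_castmx.
  by subst n; apply: splits_trmx_mxblock.
Qed.

(** Two of any three indices share a colour. *)
Lemma bool_pigeonhole (I : Type) (T : eqType) (c : I -> bool) (f : I -> T)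
    (i j k : I) :
  (forall t u, c t = c u -> f t = f u) ->
  f i != f j -> f i != f k -> f j != f k -> False.
Proof.
move=> cf; have [/cf->|cij] := eqVneq (c i) (c j); first by rewrite eqxx.
have [/cf->|cik] := eqVneq (c i) (c k); first by rewrite eqxx.
have /cf-> : c j = c k by move: cij cik; do 3!case: (c _).
by rewrite eqxx.
Qed.

Lemma uniq_unit4 (C : numClosedFieldType) : uniq [:: 1; -1; 'i; - 'i : C].
Proof.
have N11 : 1 != -1 :> C.
  by rewrite eq_sym -subr_eq0 -opprD oppr_eq0 -mulr2n pnatr_eq0.
have i1 : 1 != 'i :> C.
  by apply: contra_neq N11 => i1; rewrite -sqrCi -i1 expr1n.
have iN1 : -1 != 'i :> C.
  by apply: contra_neq N11 => iN1; rewrite -sqrCi -iN1 sqrrN expr1n.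
have iNi : 'i != - 'i :> C.
  by rewrite -subr_eq0 opprK -mulr2n mulrn_eq0 negb_or neq0Ci.
rewrite /= !inE !negb_or N11 i1 iN1 iNi eqr_opp i1 /= !andbT.
by rewrite -eqr_oppLR.
Qed.

Lemma S8_row0 (C : numClosedFieldType) (j : 'I_8) : S8 C 0 j = 1.
Proof. by case: j => -[|[|[|[|[|[|[|[|j]]]]]]]] ltj //; rewrite mxE. Qed.

Lemma S8_col0 (C : numClosedFieldType) (i : 'I_8) : S8 C i 0 = 1.
Proof. by case: i => -[|[|[|[|[|[|[|[|i]]]]]]]] lti //; rewrite mxE. Qed.

Local Notation o j := (@Ordinal 8 j%N isT).

(** The columns are passed so that their entries follow the order 1, -1, i, -i, matching the
    orientation of the inequalities in [ne]. *)
Local Ltac three_values constP ne a b d :=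
  exfalso; apply: (bool_pigeonhole (i := a) (j := b) (k := d) constP);
  by rewrite !mxE /= ?ne.

Lemma S8_not_splits (C : numClosedFieldType) : ~ splits (S8 C).
Proof.
have := uniq_unit4 C; rewrite /= !inE !negb_or !andbT.
case/and3P => /and3P[n1 n2 n3] /andP[n4 n5] n6.
have ne := (n1, n2, n3, n4, n5, n6).
case=> [c [p [p_neq pP]]].
have p0P t u : c t = c u -> S8 C (p 0) t = S8 C (p 0) u.
  by move=> ctu; have := pP 0 u t (esym ctu); rewrite !S8_row0 !mul1r.
have p1P t : c t = c 0 -> S8 C (p 1) t = S8 C 1 t.
  by move=> ct0; have := pP 1 t 0 ct0; rewrite !S8_col0 mulr1 mul1r.
have p06 : p 0 = o 6.
  have := p_neq 0; case: (p 0) p0P => -[|[|[|[|[|[|[|[|j]]]]]]]] ltj // p0P _.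
  - three_values p0P ne (o 0) (o 1) (o 2).
  - three_values p0P ne (o 0) (o 1) (o 2).
  - three_values p0P ne (o 0) (o 2) (o 4).
  - three_values p0P ne (o 0) (o 4) (o 1).
  - three_values p0P ne (o 0) (o 4) (o 1).
  - exact: val_inj.
  - three_values p0P ne (o 0) (o 2) (o 4).
have class1 t : S8 C (o 6) t = 1 -> c t = c 0.
  rewrite p06 in p0P => t1.
  (* Row [o 6] is -1 at column [o 1], so columns with entry 1 avoid that class and all lie in the
     other one. *)
  have c1 u : S8 C (o 6) u = 1 -> c u != c (o 1).
    move=> u1; apply: contraTneq n1 => /p0P; rewrite u1 mxE /= => <-.
    by rewrite eqxx.
  by move: (c1 _ t1) (c1 _ (S8_col0 _ _)); do 3!case: (c _).
(* Two columns of the class suffice: only rows 1 and 5 have [- 'i] in column 3, and column 5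
   separates them. *)
have p13 : S8 C (p 1) (o 3) == - 'i by rewrite p1P ?class1 ?mxE.
have p15 : S8 C (p 1) (o 5) == -1 by rewrite p1P ?class1 ?mxE.
have := p_neq 1.
by case: (p 1) p13 p15 => -[|[|[|[|[|[|[|[|j]]]]]]]] ltj //=; rewrite !mxE /=
  ?eqr_opp ?(eq_sym 'i (-1)) ?(negPf n1) ?(negPf n2) ?(negPf n4) ?(negPf n6).
Qed.

Lemma trmx_S8_not_splits (C : numClosedFieldType) : ~ splits (S8 C)^T.
Proof.
have := uniq_unit4 C; rewrite /= !inE !negb_or !andbT.
case/and3P => /and3P[n1 n2 n3] /andP[n4 n5] n6.
have ne := (n1, n2, n3, n4, n5, n6).
case=> [c [p [p_neq pP]]].
have p0P t u : c t = c u -> (S8 C)^T (p 0) t = (S8 C)^T (p 0) u.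
  move=> ctu; have := pP 0 u t (esym ctu).
  by rewrite ![_^T 0 _]mxE !S8_col0 !mul1r.
(* Unlike row [o 6] of [S8 C], no candidate here is real; each takes three values. *)
have := p_neq 0; case: (p 0) p0P => -[|[|[|[|[|[|[|[|j]]]]]]]] ltj // p0P _.
- three_values p0P ne (o 0) (o 1) (o 4).
- three_values p0P ne (o 0) (o 1) (o 2).
- three_values p0P ne (o 0) (o 2) (o 1).
- three_values p0P ne (o 0) (o 4) (o 3).
- three_values p0P ne (o 0) (o 1) (o 3).
- three_values p0P ne (o 0) (o 1) (o 2).
- three_values p0P ne (o 0) (o 2) (o 1).
Qed.

Theorem proposition3p2 (R : realType) :
  ~ dita_type (S8 R[i]) /\ ~ dita_type (S8 R[i])^T.
Proof.
split=> /dita8_splits; rewrite ?trmxK => -[].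
- exact: S8_not_splits.
- exact: trmx_S8_not_splits.
- exact: trmx_S8_not_splits.
- exact: S8_not_splits.
Qed.
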